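(* Let $I$ be an instance consisting of a finite bipartite graph $G=(U,W;E)$ (parallel edges allowed), preference valuations $p_v:E(v)\to\mathbb{R}_{\ge 0}$ for $v\in U\cup W$, and numbers $\gamma_e^v>0$ for each edge $e\in E$ and each endpoint $v$ of $e$. Let $M$ be the output on $I$ of the edge-duplication algorithm described in the context. Then: \begin{itemize} \item $M$ is $\gamma$-popular; \item for any matching $N$ of $G$, $|M|\ge \frac{2}{3}|N|$; \item for any $\gamma$-popular matching $N$ of $G$, $|M|\ge \frac{3}{4}|N|$; \item for any $\gamma$-min stable matching $N$ of $G$, $|M|\ge \frac{4}{5}|N|$. \end{itemize}
   Context: Setting. $G=(U,W;E)$ is a finite bipartite graph, not necessarily simple; $E(v)$ is the set of edges incident to the vertex (agent) $v$. A matching is a set $M\subseteq E$ with $|M\cap E(v)|\le 1$ for all $v$; $M(v)$ denotes the edge of $M$ incident to $v$, or $M(v)=\emptyset$ if there is none. Each agent $v$ has a valuation $p_v:E(v)\to\mathbb{R}_{\ge0}$, extended by $p_v(\emptyset)=-\infty$ (with $-\infty+r=-\infty$ for real $r$). $\gamma$-min stability. An edge $e=(u,w)\notin M$ $\gamma$-min blocks $M$ if $p_u(e)\ge p_u(M(u))+\gamma_e^u$ and $p_w(e)\ge p_w(M(w))+\gamma_e^w$. $M$ is $\gamma$-min stable if no edge $\gamma$-min blocks it. $\gamma$-popularity. For matchings $M,N$ and an agent $v$: $\mathrm{vote}^{\gamma}_v(M,N)=0$ if $M(v)=N(v)$ (as edges, or both empty). If $M(v)\neq N(v)$, then with $e=N(v)$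 (and $\gamma_\emptyset^v:=0$), $\mathrm{vote}^{\gamma}_v(M,N)=-1$ if $p_v(e)\ge p_v(M(v))+\gamma_e^v$, and $\mathrm{vote}^{\gamma}_v(M,N)=+1$ if $p_v(e)<p_v(M(v))+\gamma_e^v$. (So an agent matched in $M$ and unmatched in $N$ votes $+1$, and an agent unmatched in $M$ and matched in $N$ votes $-1$.) $M$ is $\gamma$-popular if $\Delta^{\gamma}(M,N)=\sum_{v\in U\cup W}\mathrm{vote}^{\gamma}_v(M,N)\ge 0$ for every matching $N$. The algorithm. (1) Construct an instance $I'$ of the Stable Marriage problem with strict preferences on the same vertex set: each edge $e\in E$ is replaced by six parallel copies $a(e),b(e),c(e),x(e),y(e),z(e)$. Each agent gets a strict linear order over the copies of its incident edges. Each $u\in U$ ranks them by the rule $a\succeq^{\gamma} b\succ c\succ x\succeq^{\gamma} y\succ z$, and each $w\in W$ by the rule $z\succeq^{\gamma} y\succ x\succ c\succeq^{\gamma} b\succ a$. Here, for copy types $\alpha,\beta$: $\alpha\succ\beta$ means that $\alpha(e)$ is ranked above $\beta(f)$ for all edges $e,f$ incident to the agent (and a copy type occurring earlier in the rule and separated from a later one by at least one $\succ$ is ranked entirely above it). $\alpha\succeq^{\gamma}\beta$ means that, at agent $v$, $\alpha(e)\succ_v\beta(e)$ for every $e$, and $\beta(f)\succ_v\alpha(e)$ if and only if $p_v(f)\ge p_v(e)+\gamma_f^v$. Among copies of the same type, for the types $a,c,x,z$, edges are ranked by decreasing $p_v$ with ties broken arbitrarily. The copies of types $b$ and $y$ are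 then inserted as follows. For $u\in U$: $b(f)\succ_u a(e)$ if and only if $p_u(f)\ge p_u(e)+\gamma_f^u$, and every $b$ copy is above all copies of types $c,x,y,z$; $y(f)\succ_u x(e)$ if and only if $p_u(f)\ge p_u(e)+\gamma_f^u$, and every $y$ copy is below all copies of types $a,b,c$ and above all copies of type $z$. For $w\in W$: $y(f)\succ_w z(e)$ if and only if $p_w(f)\ge p_w(e)+\gamma_f^w$, and every $y$ copy is above all copies of types $x,c,b,a$; $b(f)\succ_w c(e)$ if and only if $p_w(f)\ge p_w(e)+\gamma_f^w$, and every $b$ copy is below all copies of types $z,y,x$ and above all copies of type $a$. Any remaining ties are broken arbitrarily. (2) Run the Gale–Shapley algorithm on $I'$ to obtain a stable matching $M'$ of $I'$ (no copy outside $M'$ is strictly preferred by both of its endpoints to their situation in $M'$, being unmatched being worst). (3) Output the projection $M=\{e\in E: \text{some copy of } e \text{ is in } M'\}$. *)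

(* Defs.v *)
From HB Require Import structures.
From mathcomp Require Import all_boot all_order all_algebra.
From mathcomp Require Import reals constructive_ereal.

Set Implicit Arguments.
Unset Strict Implicit.
Unset Printing Implicit Defensive.

Import Order.TTheory GRing.Theory Num.Theory.
Local Open Scope ring_scope.

(* Edges are an abstract finite type, so parallel edges are allowed. *)
Record bigraph := BiGraph {
  lside : finType;
  rside : finType;
  edge : finType;
  lend : edge -> lside;
  rend : edge -> rside
}.

Definition agent (G : bigraph) : finType := (lside G + rside G)%type.

(* The endpoint of e in U if b = false, in W if b = true. *)
Definition endpoint (G : bigraph) (b : bool) (e : edge G) : agent G :=
  if b then inr (rend e) else inl (lend e).

Definition incident (G : bigraph) (v : agent G) : {set edge G} :=
  [set e | (endpoint false e == v) || (endpoint true e == v)].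

Definition matching (G : bigraph) (M : {set edge G}) : Prop :=
  forall v : agent G, (#|M :&: incident v| <= 1)%N.

(* M(v), with None standing for the empty set. *)
Definition mate (G : bigraph) (M : {set edge G}) (v : agent G) :
  option (edge G) := [pick e in M :&: incident v].

Section Valuations.
Variables (R : realType) (G : bigraph).
(* Both p v e and gamma v e are meaningful only for e incident to v. *)
Variables p gamma : agent G -> edge G -> R.

Definition pext (v : agent G) (o : option (edge G)) : \bar R :=
  if o is Some e then (p v e)%:E else -oo%E.

Definition gext (v : agent G) (o : option (edge G)) : R :=
  if o is Some e then gamma v e else 0.

Definition gamma_min_blocks (M : {set edge G}) (e : edge G) : Prop :=
  e \notin M /\
  forall b : bool, let v := endpoint b e in
    (pext v (mate M v) + (gamma v e)%:E <= (p v e)%:E)%E.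

Definition gamma_min_stable (M : {set edge G}) : Prop :=
  matching M /\ forall e : edge G, ~ gamma_min_blocks M e.

Definition vote (v : agent G) (M N : {set edge G}) : int :=
  if mate M v == mate N v then 0
  else if (pext v (mate M v) + (gext v (mate N v))%:E <= pext v (mate N v))%E
       then -1 else 1.

Definition Delta (M N : {set edge G}) : int := \sum_(v : agent G) vote v M N.

Definition gamma_popular (M : {set edge G}) : Prop :=
  matching M /\ forall N : {set edge G}, matching N -> 0 <= Delta M N.

End Valuations.

Inductive copy_type := Ca | Cb | Cc | Cx | Cy | Cz.

Definition copy_type_to_ord (t : copy_type) : 'I_6 :=
  match t with
  | Ca => @Ordinal 6 0 isT | Cb => @Ordinal 6 1 isT | Cc => @Ordinal 6 2 isT
  | Cx => @Ordinal 6 3 isT | Cy => @Ordinal 6 4 isT | Cz => @Ordinal 6 5 isT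
  end.

Definition copy_type_of_ord (i : 'I_6) : copy_type :=
  nth Ca [:: Ca; Cb; Cc; Cx; Cy; Cz] i.

Lemma copy_type_to_ordK : cancel copy_type_to_ord copy_type_of_ord.
Proof. by case. Qed.

HB.instance Definition _ := Finite.copy copy_type (can_type copy_type_to_ordK).

Definition six_copies (G : bigraph) : bigraph :=
  @BiGraph (lside G) (rside G) (copy_type * edge G)%type
    (fun c => lend c.2) (fun c => rend c.2).

(* Position of a copy type among the blocks separated by the strict signs in
   a >=^g b > c > x >=^g y > z  on U,  z >=^g y > x > c >=^g b > a  on W. *)
Definition tier (G : bigraph) (v : agent G) (t : copy_type) : nat :=
  match v, t with
  | inl _, (Ca | Cb) => 0
  | inl _, Cc => 1
  | inl _, (Cx | Cy) => 2
  | inl _, Cz => 3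
  | inr _, (Cz | Cy) => 0
  | inr _, Cx => 1
  | inr _, (Cc | Cb) => 2
  | inr _, Ca => 3
  end.

(* The pairs s >=^g t of the same two rules. *)
Definition succeq_gamma (G : bigraph) (v : agent G) (s t : copy_type) : bool :=
  match v, s, t with
  | inl _, Ca, Cb | inl _, Cx, Cy | inr _, Cz, Cy | inr _, Cc, Cb => true
  | _, _, _ => false
  end.

Definition strict_linear_on (T : finType) (A : {set T}) (r : rel T) : Prop :=
  [/\ {in A, irreflexive r}, {in A & &, transitive r} &
      {in A &, forall c d, c != d -> r c d || r d c}].

(* r c d means that v strictly prefers c to d.  Every linear order obeying the
   rule is admitted: this is the arbitrary tie-breaking. *)
Definition follows_rule (R : realType) (G : bigraph)
    (p gamma : agent G -> edge G -> R)
    (v : agent G) (r : rel (edge (six_copies G))) : Prop :=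
  strict_linear_on (incident (v : agent (six_copies G))) r /\
  forall e f : edge G, e \in incident v -> f \in incident v ->
  [/\ forall s t, (tier v s < tier v t)%N -> r (s, e) (t, f),
      forall s, s \in [:: Ca; Cc; Cx; Cz] -> p v f < p v e -> r (s, e) (s, f),
      forall s t, succeq_gamma v s t -> r (s, e) (t, e) &
      forall s t, succeq_gamma v s t ->
        (r (t, f) (s, e) <-> p v e + gamma v f <= p v f)].

(* Deferred acceptance in rounds: in each round every agent of the proposing
   side b proposes along its favourite not yet rejected edge, and every agent
   of the other side rejects all proposals received but the best one.  At most
   #|edge H| rounds can reject something. *)
Section GaleShapley.
Variables (H : bigraph) (pref : agent H -> rel (edge H)) (b : bool).

Definition proposals (rejected : {set edge H}) : {set edge H} :=
  [set e | (e \notin rejected) &&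
    [forall f, [&& f \notin rejected, endpoint b f == endpoint b e & f != e]
               ==> pref (endpoint b e) e f]].

Definition gs_round (rejected : {set edge H}) : {set edge H} :=
  rejected :|:
  [set e in proposals rejected |
    [exists f in proposals rejected,
      (endpoint (~~ b) f == endpoint (~~ b) e)
      && pref (endpoint (~~ b) e) f e]].

Definition gale_shapley : {set edge H} :=
  proposals (iter #|edge H| gs_round set0).

End GaleShapley.

Definition projection (G : bigraph) (M' : {set edge (six_copies G)}) :
  {set edge G} := [set e | [exists t : copy_type, (t, e) \in M']].

(* M is an output for some tie-breaking and some choice of proposing side. *)
Definition edge_duplication_output (R : realType) (G : bigraph)
    (p gamma : agent G -> edge G -> R) (M : {set edge G}) : Prop :=
  exists (pref : agent G -> rel (edge (six_copies G))) (b : bool),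
    (forall v, follows_rule p gamma v (pref v)) /\
    M = projection (gale_shapley (H := six_copies G) pref b).

(* Main.v *)
Require Import Defs.
From mathcomp Require Import all_boot all_order all_algebra.
From mathcomp Require Import reals constructive_ereal.
From mathcomp Require Import lra.
Import Order.TTheory GRing.Theory Num.Theory.
Local Open Scope ring_scope.

Set Implicit Arguments.
Unset Strict Implicit.
Unset Printing Implicit Defensive.

(* If [v] gains at least [gamma] by passing from [M(v)] to [e], then [v] prefers
   to its copy in the stable matching every copy of [e] whose type is in the
   same or in a better tier. Call an edge of [M] far for [U] if its copy has
   type x, y or z, and far for [W] if it has type a, b or c. The potential that
   is 1 at an endpoint for whose side the [M]-edge is far, -1 at the other
   endpoint, and 0 at unmatched agents has sum 0, and on every edge it is at
   most the sum of the two votes; hence [M] is popular.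

   The size bounds come from fractional vertex covers of [N]. Call an edge [f]
   of [M] a tip if some edge of [N] joins one of its ends to an agent unmatched
   by [M]. If an edge of [N] joins the other end of a tip [f] to an [M]-edge that
   is far for the side it is reached on, then [f] gamma-min blocks [N]; if that
   [M]-edge is itself a tip, both block, and exchanging along the resulting
   augmenting path with three edges of [N] wins the vote against [N]. The cover
   gives weight [s] to each edge of [M]: on a tip, 1 goes to the end next to the
   unmatched agent and [s - 1] to the other; elsewhere [h] goes to the end on the
   far side and [s - h] to the other. The values of [(s, h)] are (3/2, 3/4),
   (4/3, 2/3) and (5/4, 1/2). *)

(** Take an element with the most elements of [P] below it: anything ranked above it would have all
    of these and the element itself below. *)
Lemma strict_linear_max (T : finType) (A P : {set T}) (r : rel T) (x : T) :
  strict_linear_on A r -> P \subset A -> x \in P ->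
  exists2 y, y \in P & {in P, forall z, z = y \/ r y z}.
Proof.
move=> [irr tr tot] /subsetP PA xP.
pose m y := #|[set z in P | r y z]|.
case: (@arg_maxnP _ x [in P] m xP) => y yP ymax; exists y => // z zP.
case: (eqVneq z y) => [|zy]; [by left | right].
case/orP: (tot z y (PA _ zP) (PA _ yP) zy) => // rzy.
have : (m z <= m y)%N := ymax z zP; rewrite leqNgt => /negP[].
apply/proper_card/properP; split.
  apply/subsetP => w; rewrite !inE => /andP[wP ryw]; rewrite wP.
  by apply: (tr y); rewrite ?PA.
by exists y; rewrite inE yP //= irr ?PA.
Qed.

(** * Ends of edges and matchings in a bipartite graph *)

Arguments endpoint : simpl never.

Section BipartiteGraph.
Variable G : bigraph.
Implicit Types (b : bool) (e f : edge G) (v : agent G) (M N : {set edge G}).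

Lemma incidentP v e :
  reflect (exists b, endpoint b e = v) (e \in incident v).
Proof.
rewrite inE; apply: (iffP orP) => [[/eqP<-|/eqP<-]|[[] <-]].
- by exists false.
- by exists true.
- by right.
- by left.
Qed.

Lemma incident_endpoint b e : e \in incident (endpoint b e).
Proof. by apply/incidentP; exists b. Qed.

Lemma endpoint_side b b' e f : endpoint b e = endpoint b' f -> b = b'.
Proof. by case: b; case: b'. Qed.

Lemma incident_endpointE b e f :
  (f \in incident (endpoint b e)) = (endpoint b f == endpoint b e).
Proof.
apply/incidentP/eqP => [[b' ef]|]; last by exists b.
by rewrite -ef; congr endpoint; apply: endpoint_side (esym ef).
Qed.

Lemma matchingP M : matching M <-> forall b, {in M &, injective (endpoint b)}.
Proof.
split=> [mM b e f eM fM ef|mM v].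
  apply: (card_le1_eqP (mM (endpoint b e))).
  by rewrite in_setI fM incident_endpointE ef eqxx.
  by rewrite in_setI eM incident_endpoint.
apply/card_le1_eqP => e f /setIP[eM /incidentP[b <-]] /setIP[fM].
by rewrite incident_endpointE => /eqP fe; apply: (mM b).
Qed.

Lemma mate_some M b e f :
  mate M (endpoint b e) = Some f -> f \in M /\ endpoint b f = endpoint b e.
Proof.
rewrite /mate; case: pickP => // g /setIP[gM ge] [<-].
by move: ge; rewrite incident_endpointE => /eqP.
Qed.

Lemma mate_none M b e f :
  mate M (endpoint b e) = None -> f \in M -> endpoint b f <> endpoint b e.
Proof.
rewrite /mate; case: pickP => // none _ fM /eqP fe.
by have := none f; rewrite in_setI fM incident_endpointE fe.
Qed.

Lemma mate_endpoint M b e f : matching M -> f \in M ->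
  endpoint b f = endpoint b e -> mate M (endpoint b e) = Some f.
Proof.
move=> /matchingP mM fM fe; case mate_e: (mate M _) => [g|].
  have [gM ge] := mate_some mate_e.
  by congr Some; apply: (mM b); rewrite ?ge.
by case: (mate_none mate_e fM).
Qed.

(** Double counting of incidences: a matched agent lies on one edge of [M], and an edge has one end
    on each side. *)
Lemma sum_matched (K : nmodType) M (F : agent G -> K) : matching M ->
  \sum_(v | mate M v) F v =
  \sum_(e in M) (F (endpoint false e) + F (endpoint true e)).
Proof.
move=> mM; transitivity (\sum_v \sum_(e in M | e \in incident v) F v).
  rewrite big_mkcond; apply: eq_bigr => v _; rewrite /mate.
  case: pickP => [e /setIP[eM ev]|none] /=; last first.
    by rewrite big_pred0 // => e; have := none e; rewrite in_setI.
  rewrite (big_pred1 e) // => f; apply/andP/eqP => [[fM fv]|->//].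
  by apply: (card_le1_eqP (mM v)); rewrite in_setI ?eM ?fM.
rewrite (exchange_big_dep (mem M)) /=; last by move=> v e _ /andP[].
apply: eq_bigr => e eM; rewrite (bigD1 (endpoint false e)) /=; last first.
  by rewrite eM incident_endpoint.
rewrite (big_pred1 (endpoint true e)) // => v /=.
rewrite eM /=; apply/andP/eqP => [[/incidentP[[] <-] //]|->].
  by rewrite eqxx.
by rewrite (incident_endpoint true e); split=> //; apply/eqP => /endpoint_side.
Qed.

End BipartiteGraph.

(** * Correctness of deferred acceptance *)

Section GaleShapleyCorrect.
Variables (H : bigraph) (pref : agent H -> rel (edge H)) (b : bool).
Hypothesis pref_lin : forall v, strict_linear_on (incident v) (pref v).
Implicit Types (rej : {set edge H}) (c d e : edge H).

Let irr v c : c \in incident v -> pref v c c = false.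
Proof. by case: (pref_lin v) => irr _ _ /irr. Qed.

Let asym v c d : c \in incident v -> d \in incident v ->
  pref v c d -> pref v d c -> False.
Proof.
move=> cv dv cd dc; have [_ tr _] := pref_lin v.
by have := tr _ _ _ dv cv cv cd dc; rewrite irr.
Qed.

Lemma proposalsP rej e :
  reflect (e \notin rej /\ forall f, f \notin rej ->
             endpoint b f = endpoint b e -> f != e -> pref (endpoint b e) e f)
    (e \in proposals pref b rej).
Proof.
rewrite inE; apply: (iffP andP) => -[erej best]; split=> //.
  move=> f frej fe nfe; apply: (implyP (forallP best f)).
  by rewrite frej fe eqxx.
by apply/forallP => f; apply/implyP => /and3P[? /eqP ? ?]; apply: best.
Qed.

(** The best proposal at a receiving agent survives the round, and it stays its proposer's favourite
    because the unrejected competitors only shrink. *)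
Let best_proposal rej c : c \in proposals pref b rej ->
  exists d, [/\ d \in proposals pref b (gs_round pref b rej),
    endpoint (~~ b) d = endpoint (~~ b) c &
    d = c \/ pref (endpoint (~~ b) c) d c].
Proof.
move=> cprop; set v := endpoint (~~ b) c.
have [||d] := @strict_linear_max _ _ (proposals pref b rej :&: incident v) _ c
  (pref_lin v).
- exact: subsetIr.
- by rewrite in_setI cprop incident_endpoint.
move=> /setIP[dprop dv] dmax.
have dc : endpoint (~~ b) d = v by apply/eqP; rewrite -incident_endpointE.
exists d; split=> //; last first.
  by case: (dmax c); rewrite ?in_setI ?cprop ?incident_endpoint //;
    [left | right].
have [drej dbest] := proposalsP _ _ dprop.
apply/proposalsP; split=> [|f]; last first.
  by rewrite inE negb_or => /andP[frej _]; apply: dbest.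
rewrite inE negb_or drej inE dprop /=; apply/existsPn => f; rewrite negb_and.
apply/orP; case: (boolP (f \in _)) => [fprop|]; last by left.
right; rewrite dc; apply/negP => /andP[/eqP fv fd].
have fin : f \in incident v by rewrite incident_endpointE fv.
case: (dmax f); first by rewrite in_setI fprop.
  by move=> fd'; move: fd; rewrite fd' irr.
by move/(asym dv fin); apply.
Qed.

(** Invariant of the rounds: what a receiving agent holds only improves, so every past rejection is
    still justified by a current proposal. *)
Let rejected_for_better n c : c \in iter n (gs_round pref b) set0 ->
  exists d, [/\ d \in proposals pref b (iter n (gs_round pref b) set0),
    endpoint (~~ b) d = endpoint (~~ b) c & pref (endpoint (~~ b) c) d c].
Proof.
elim: n c => [|n IH] c; first by rewrite inE.
have improve d : d \in proposals pref b (iter n (gs_round pref b) set0) ->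
    endpoint (~~ b) d = endpoint (~~ b) c -> pref (endpoint (~~ b) c) d c ->
  exists d, [/\ d \in proposals pref b (iter n.+1 (gs_round pref b) set0),
    endpoint (~~ b) d = endpoint (~~ b) c & pref (endpoint (~~ b) c) d c].
  move=> /best_proposal[f [fprop fd dbest]] dc prefdc.
  exists f; split=> //; first by rewrite fd.
  case: dbest => [->//|]; rewrite dc => preffd.
  have [_ tr _] := pref_lin (endpoint (~~ b) c).
  by apply: (tr d); rewrite ?incident_endpointE ?fd ?dc.
rewrite iterS inE => /orP[/IH[d []]|]; first exact: improve.
rewrite inE => /andP[_ /existsP[d /and3P[dprop /eqP dc prefdc]]].
exact: improve dprop dc prefdc.
Qed.

Let rejected := iter #|edge H| (gs_round pref b) set0.

(** A round that changes anything rejects a new edge, so after [#|edge H|] rounds either a fixed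
    point is reached or all edges are rejected. *)
Let rejected_fixpoint : gs_round pref b rejected = rejected.
Proof.
have sub rej : rej \subset gs_round pref b rej by apply: subsetUl.
have grow n : gs_round pref b (iter n (gs_round pref b) set0) =
    iter n (gs_round pref b) set0 \/ (n <= #|iter n (gs_round pref b) set0|)%N.
  elim: n => [|n [IH|IH]]; first by right.
    by left; rewrite iterS !IH.
  rewrite iterS; set rej := iter n _ _ in IH *.
  have [eq_rej|neq_rej] := eqVneq (gs_round pref b rej) rej.
    by left; rewrite !eq_rej.
  right; apply: leq_ltn_trans IH _; apply: proper_card.
  by rewrite properEneq eq_sym neq_rej sub.
case: (grow #|edge H|) => // full; rewrite -/rejected in full *.
by apply/eqP; rewrite eq_sym eqEcard sub (leq_trans (max_card _) full).
Qed.

(** Two proposals by one agent would each be its strict favourite; of two received by one agent, a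
    further round would reject the worse, against the fixed point. *)
Lemma gale_shapley_inj b' :
  {in gale_shapley pref b &, injective (endpoint b')}.
Proof.
move=> c d cM dM cd; apply/eqP/negPn/negP => ncd.
have [crej cbest] := proposalsP _ _ cM; have [drej dbest] := proposalsP _ _ dM.
have [b'b|/negPf b'b] := eqVneq b' b.
  rewrite b'b in cd.
  have prefcd := cbest d drej (esym cd); have prefdc := dbest c crej cd ncd.
  rewrite eq_sym in ncd; move: prefdc; rewrite -cd.
  by apply: asym (prefcd ncd); rewrite incident_endpointE ?cd.
have {}b'b : b' = ~~ b by move: b'b; case: (b'); case: (b).
rewrite {}b'b in cd.
have loses e f : e \in gale_shapley pref b -> f \in gale_shapley pref b ->
    endpoint (~~ b) e = endpoint (~~ b) f -> ~~ pref (endpoint (~~ b) e) f e.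
  move=> eM fM ef; apply/negP => prefef.
  have [/negP[]] := proposalsP _ _ eM.
  rewrite -/rejected -rejected_fixpoint in_setU inE eM; apply/orP; right.
  by apply/existsP; exists f; rewrite fM ef eqxx -ef.
have [_ _ tot] := pref_lin (endpoint (~~ b) c).
have := tot c d; rewrite !incident_endpointE cd eqxx -cd => /(_ isT isT ncd).
by rewrite (negPf (loses c d _ _ _)) // cd (negPf (loses d c _ _ _)).
Qed.

(** A rejected [c] is beaten at its receiver; otherwise its proposer's favourite unrejected edge is
    [c] or better. *)
Lemma gale_shapley_stable c : exists b' d,
  [/\ d \in gale_shapley pref b, endpoint b' d = endpoint b' c &
      d = c \/ pref (endpoint b' c) d c].
Proof.
have [/rejected_for_better[d [dM dc prefdc]]|crej] := boolP (c \in rejected).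
  by exists (~~ b), d; split=> //; right.
have [||d] := @strict_linear_max _ _
  (~: rejected :&: incident (endpoint b c)) _ c (pref_lin (endpoint b c)).
- exact: subsetIr.
- by rewrite in_setI in_setC crej incident_endpoint.
rewrite in_setI incident_endpointE in_setC => /andP[drej /eqP dc] dmax.
exists b, d; split=> //; last first.
  have []// := dmax c; last by right.
    by rewrite in_setI incident_endpoint in_setC crej.
  by left.
apply/proposalsP; split=> // f frej fd fnd.
have [|fd'|] := dmax f.
- by rewrite in_setI incident_endpointE in_setC frej fd dc eqxx.
- by rewrite fd' eqxx in fnd.
- by rewrite dc.
Qed.

End GaleShapleyCorrect.

(** * From the algorithm to conditions on the copies *)

Section Duplication.
Variables (R : realType) (G : bigraph) (p gamma : agent G -> edge G -> R).
Implicit Types (b : bool) (e f : edge G) (v : agent G) (M N : {set edge G}).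
Implicit Types (s t : copy_type).
Hypothesis gamma_gt0 : forall v e, e \in incident v -> 0 < gamma v e.

(** The common inequality of blocking, of a vote of -1 and of the insertion of b and y copies. *)
Definition exceeds v e f : bool := p v f + gamma v e <= p v e.

Lemma exceeds_gt v e f : e \in incident v -> exceeds v e f -> p v f < p v e.
Proof. by move=> /gamma_gt0 ge0; apply: lt_le_trans; rewrite ltrDl. Qed.

Lemma copy_incident v (c : edge (six_copies G)) :
  (c \in incident (v : agent (six_copies G))) = (c.2 \in incident v).
Proof. by rewrite !inE. Qed.

(** A tier holds one primary type (a, c, x or z) and possibly one type inserted into it; the cases
    tell which of these [s] and [t] are. *)
Lemma tier_eq_cases v s t : tier v s = tier v t ->
  [\/ s = t /\ s \in [:: Ca; Cc; Cx; Cz],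
      s = t /\ exists2 s', succeq_gamma v s' s & s' \in [:: Ca; Cc; Cx; Cz],
      succeq_gamma v s t /\ s \in [:: Ca; Cc; Cx; Cz] |
      succeq_gamma v t s].
Proof.
by case: v => ?; case: s; case: t => //= _;
  do ?[exact: Or41 | exact: Or43 | exact: Or44];
  apply: Or42; split=> //;
  do ?[by exists Ca | by exists Cx | by exists Cc | by exists Cz].
Qed.

Lemma exceeds_pref v r s t e f :
  follows_rule p gamma v r -> e \in incident v -> f \in incident v ->
  exceeds v e f -> (tier v s <= tier v t)%N -> r (s, e) (t, f).
Proof.
move=> [[_ tr _] rule] ev fv ef.
have [lower same _ _] := rule e f ev fv.
have [_ _ _ thr] := rule f e fv ev; have [_ _ own _] := rule f f fv fv.
have {}tr c d c' : c.2 \in incident v -> d.2 \in incident v ->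
    c'.2 \in incident v -> r c d -> r d c' -> r c c'.
  by move=> *; apply: (tr d); rewrite ?copy_incident.
have lt_fe := exceeds_gt ev ef.
rewrite leq_eqVlt => /orP[/eqP|]; last exact: lower.
case/tier_eq_cases => [[<- sprim]|[<- [s' s's s'prim]]|[st sprim]|ts].
- exact: same.
(* The rule does not compare two inserted copies directly; the primary copy of [f] is placed between
   them. *)
- by apply: (tr _ (s', f)) => //; [apply/thr | apply: own].
- by apply: (tr _ (s, f)) => //; [apply: same | apply: own].
- exact/thr.
Qed.

(* [copy f] is the type of the copy of [f] in the stable matching; the last
   three conditions hold when [v] does not prefer [(t, e)] to [(copy f, f)]. *)
Definition stable_copies M (copy : edge G -> copy_type) : Prop :=
  forall t e, exists b f, let v := endpoint b e in
  [/\ mate M v = Some f,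
      (tier v (copy f) <= tier v t)%N,
      exceeds v e f -> (tier v (copy f) < tier v t)%N &
      succeq_gamma v t (copy f) -> exceeds v f e].

(** This is all that is used of the algorithm below: popularity and the size bounds rest on these
    conditions only. *)
Lemma output_stable_copies M : edge_duplication_output p gamma M ->
  matching M /\ exists copy, stable_copies M copy.
Proof.
move=> [pref [b0 [rule ->]]]; set M' := gale_shapley _ _.
have lin (v : agent (six_copies G)) :
    strict_linear_on (incident v) (pref v) by case: (rule v).
have injM' b : {in M' &, injective (@endpoint (six_copies G) b)}.
  exact: gale_shapley_inj.
have projP e : reflect (exists t, (t, e) \in M') (e \in projection M').
  by rewrite inE; apply: existsP.
have matching_proj : matching (projection M').
  apply/matchingP => b e f /projP[s sM] /projP[t tM] ef.
  by case: (injM' b _ _ sM tM ef).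
(* The default [Ca] only concerns edges outside the projection. *)
split=> //; pose copy f := odflt Ca [pick t | (t, f) \in M'].
have copyE t f : (t, f) \in M' -> copy f = t.
  rewrite /copy => tM; case: pickP => [s sM|/(_ t)]; last by rewrite tM.
  by case: (injM' true _ _ sM tM erefl).
exists copy => t e.
have [b [[s f] [fM fe pref_f]]] :=
  gale_shapley_stable b0 lin ((t, e) : edge (six_copies G)).
exists b, f => v; have {}fe : endpoint b f = v by exact: fe.
have {}pref_f : (s, f) = (t, e) \/ pref v (s, f) (t, e) by exact: pref_f.
rewrite (copyE _ _ fM).
have ev : e \in incident v by rewrite incident_endpoint.
have fv : f \in incident v by rewrite incident_endpointE fe.
have [[irr tr _] _] := rule v.
have npref : ~~ pref v (t, e) (s, f).
  case: pref_f => [<-|pref_f].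
    by rewrite irr // copy_incident.
  apply/negP => pref_e.
  have := tr (t, e) (s, f) (s, f); rewrite !copy_incident.
  by rewrite irr ?copy_incident // => /(_ ev fv fv pref_f pref_e).
split=> //.
- by apply: mate_endpoint fe => //; apply/projP; exists s.
- rewrite leqNgt; apply: contra npref => lt_ts.
  by case: (rule v) => _ /(_ e f ev fv)[lower _ _ _]; apply: lower.
- move=> ef; rewrite ltnNge; apply: contra npref.
  exact: exceeds_pref.
- move=> succ; case: pref_f => [[st _]|].
    by move: succ; rewrite st; case: (v) (t) => ? [].
  by case: (rule v) => _ /(_ e f ev fv)[_ _ _ thr] /thr; apply.
Qed.

(** * Votes, and an exchange along a path *)

Lemma vote_some v M N e f : mate M v = Some f -> mate N v = Some e ->
  e != f -> vote p gamma v M N = if exceeds v e f then -1 else 1.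
Proof.
move=> Mv Nv nef; rewrite /vote Mv Nv /= -EFinD lee_fin.
by case: eqP => // -[/esym/eqP]; rewrite (negPf nef).
Qed.

Lemma vote_exposed v M N : mate N v = None ->
  vote p gamma v M N = if mate M v then 1 else 0.
Proof. by move=> Nv; rewrite /vote Nv; case: (mate M v). Qed.

Lemma vote_same v M N : mate M v = mate N v -> vote p gamma v M N = 0.
Proof. by move=> MN; rewrite /vote MN eqxx. Qed.

Lemma vote_ge v M N : -1 <= vote p gamma v M N.
Proof. by rewrite /vote; do 2?case: ifP. Qed.

Lemma vote_le v M N : vote p gamma v M N <= 1.
Proof. by rewrite /vote; do 2?case: ifP. Qed.

(** Replacing [e0], [e1], [e2] by [f1], [f2] along the path [e0 f1 e1 f2 e2] makes its four inner
    agents vote -1; its two ends vote at most 1 and all others 0. *)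
Lemma swap_path_vote N b e0 e1 e2 f1 f2 :
  matching N -> e0 \in N -> e1 \in N -> e2 \in N -> uniq [:: e0; e1; e2] ->
  endpoint (~~ b) f1 = endpoint (~~ b) e0 ->
  endpoint b f1 = endpoint b e1 ->
  endpoint (~~ b) f2 = endpoint (~~ b) e1 ->
  endpoint b f2 = endpoint b e2 ->
  exceeds (endpoint (~~ b) f1) f1 e0 -> exceeds (endpoint b f1) f1 e1 ->
  exceeds (endpoint (~~ b) f2) f2 e1 -> exceeds (endpoint b f2) f2 e2 ->
  ~ gamma_popular p gamma N.
Proof.
move=> mN e0N e1N e2N uniq_e fe0 fe1 fe1' fe2 x0 x1 x1' x2 [_ popN].
have /matchingP injN := mN.
have [e01 e02 e12] : [/\ e0 != e1, e0 != e2 & e1 != e2].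
  by move: uniq_e; rewrite /= !inE negb_or andbT => /andP[/andP[]].
have sides c : c = b \/ c = ~~ b by case: (c) (b) => [] []; auto.
have ends c e f : e \in N -> f \in N -> e != f ->
    (endpoint c e == endpoint c f) = false.
  by move=> eN fN nef; apply/eqP => /(injN c _ _ eN fN)/eqP; apply/negP.
have cross e f : (endpoint b e == endpoint (~~ b) f) = false.
  by apply/eqP => /endpoint_side; case: (b).
have cross' e f : (endpoint (~~ b) e == endpoint b f) = false.
  by rewrite eq_sym cross.
have distinct := (cross, cross', ends _ _ _ e0N e1N e01, ends _ _ _ e0N e2N e02,
  ends _ _ _ e1N e2N e12).
pose N' := (N :\: [set e0; e1; e2]) :|: [set f1; f2].
have f1N' : f1 \in N' by rewrite !inE eqxx orbT.
have f2N' : f2 \in N' by rewrite !inE eqxx !orbT.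
have replaces c f : f \in [set f1; f2] ->
    exists2 e, e \in [set e0; e1; e2] & endpoint c f = endpoint c e.
  rewrite !inE => /orP[]/eqP->; case: (sides c) => ->.
  - by exists e1; rewrite // !inE eqxx orbT.
  - by exists e0; rewrite // !inE eqxx.
  - by exists e2; rewrite // !inE eqxx !orbT.
  - by exists e1; rewrite // !inE eqxx orbT.
have subN e : e \in [set e0; e1; e2] -> e \in N.
  by rewrite !inE => /orP[/orP[]|] /eqP->.
have f12 c : endpoint c f1 != endpoint c f2.
  by case: (sides c) => ->; rewrite ?fe1 ?fe2 ?fe0 ?fe1' distinct.
have mN' : matching N'.
  have kept c g f : g \in N :\: [set e0; e1; e2] -> f \in [set f1; f2] ->
      endpoint c g <> endpoint c f.
    move=> /setDP[gN gE] /(replaces c)[e eE ->] /(injN c _ _ gN (subN _ eE)) ge.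
    by rewrite ge eE in gE.
  apply/matchingP => c g g' /setUP[gN|gF] /setUP[gN'|gF'] gg'.
  - by apply: (injN c) gg'; [move: gN | move: gN'] => /setDP[].
  - by case: (kept c _ _ gN gF').
  - by case: (kept c _ _ gN' gF (esym gg')).
  - move: gF gF' gg'; rewrite !inE => /orP[]/eqP-> /orP[]/eqP-> // /eqP.
      by rewrite (negPf (f12 c)).
    by rewrite eq_sym (negPf (f12 c)).
pose S :=
  [:: endpoint (~~ b) f1; endpoint b f1; endpoint (~~ b) f2; endpoint b f2].
pose T := [:: endpoint b e0; endpoint (~~ b) e2].
have vote_swap c e f : e \in N -> f \in N' -> endpoint c f = endpoint c e ->
    exceeds (endpoint c f) f e -> vote p gamma (endpoint c f) N N' = -1.
  move=> eN fN' fe exc.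
  have := @vote_some (endpoint c f) N N' f e.
  rewrite exc; apply; [exact: mate_endpoint | exact: mate_endpoint |].
  (* Since [gamma] is positive, no edge exceeds itself. *)
  apply: contraTneq exc => ->.
  by rewrite /exceeds -ltNge ltrDl gamma_gt0 ?incident_endpoint.
have vote_S v : v \in S -> vote p gamma v N N' = -1.
  rewrite !inE => /or4P[]/eqP->.
  - exact: vote_swap e0N _ _ _.
  - exact: vote_swap e1N _ _ _.
  - exact: vote_swap e1N _ _ _.
  - exact: vote_swap e2N _ _ _.
have uniqS : uniq S.
  rewrite /= !inE !negb_or andbT fe0 fe1 fe1' fe2.
  by rewrite !distinct.
have disjT v : v \in T -> v \notin S.
  rewrite !inE !negb_or => /orP[]/eqP->; rewrite fe0 fe1 fe1' fe2.
    by rewrite !distinct.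
  by rewrite !(eq_sym (endpoint (~~ b) e2)) !distinct.
have vote_rest v : v \notin S -> v \notin T -> vote p gamma v N N' = 0.
  move=> vS vT; apply: vote_same.
  have notin c g : g \in [set e0; e1; e2] :|: [set f1; f2] -> endpoint c g != v.
    move: vS vT; rewrite !inE !negb_or !(eq_sym v) fe0 fe1 fe1' fe2.
    move=> /and4P[v1 v2 v3 v4] /andP[v5 v6].
    by case: (sides c) => -> /orP[/orP[/orP[]|]|/orP[]] /eqP->;
      rewrite ?fe0 ?fe1 ?fe1' ?fe2.
  (* Off the path both matchings have the same edges at [v]. *)
  rewrite /mate (_ : N' :&: incident v = N :&: incident v) //.
  apply/setP => g; rewrite !in_setI.
  have [/incidentP[c gv]|] := boolP (g \in incident v); last by rewrite !andbF.
  have := notin c g; rewrite gv eqxx !inE.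
  by case: (g == e0); case: (g == e1); case: (g == e2); case: (g == f1);
    case: (g == f2) => //= absurd; rewrite ?orbF //; have := absurd isT.
have count (s : seq (agent G)) : \sum_v ((v \in s)%:R : int) = #|s|%:R.
  rewrite -sum1_card natr_sum [RHS]big_mkcond; apply: eq_bigr => v _.
  by case: (v \in s).
have := popN N' mN'; apply/negP; rewrite -ltNge.
apply: (@le_lt_trans _ _ (\sum_v ((v \in T)%:R - (v \in S)%:R))).
  apply: ler_sum => v _; case: (boolP (v \in S)) => [vS|vS].
    by rewrite vote_S // (negPf (contraL (disjT v) vS)).
  case: (boolP (v \in T)) => vT; last by rewrite vote_rest.
  by rewrite subr0 vote_le.
rewrite sumrB !count (card_uniqP uniqS) subr_lt0 ltr_nat.
by apply: leq_ltn_trans (card_size _) _.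
Qed.

(** * Constraints that stability puts on single edges *)

Definition side_tier b t : nat :=
  if b then match t with Cz | Cy => 0 | Cx => 1 | Cc | Cb => 2 | Ca => 3 end%N
  else match t with Ca | Cb => 0 | Cc => 1 | Cx | Cy => 2 | Cz => 3 end%N.

Lemma tier_endpoint b e t : tier (endpoint b e) t = side_tier b t.
Proof. by case: b; case: t. Qed.

(** The cut is in the middle of both rules, so each type is far for exactly one side. *)
Definition far b t : bool := (2 <= side_tier b t)%N.

Lemma far_negb b t : far (~~ b) t = ~~ far b t.
Proof. by case: b; case: t. Qed.

Section StableCopies.
Variables (M : {set edge G}) (copy : edge G -> copy_type).
Hypotheses (mM : matching M) (stabM : stable_copies M copy).

Lemma exposed_end b e : mate M (endpoint b e) = None -> exists f,
  [/\ mate M (endpoint (~~ b) e) = Some f, side_tier (~~ b) (copy f) = 0%N,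
      ~~ exceeds (endpoint (~~ b) e) e f &
      side_tier b (copy f) = 2%N -> exceeds (endpoint (~~ b) e) f e].
Proof.
move=> none.
(* The primary type of the top tier at the matched end: only an edge of that tier can hold it
   off. *)
have [b' [f /= [mate_f le lt succ]]] := stabM (if b then Ca else Cz) e.
have b'b : b' = ~~ b.
  by move: mate_f none; case: (b') (b) => [] [] // ->.
rewrite {b'}b'b !tier_endpoint in mate_f le lt succ; exists f; split=> //.
- by move: le; case: (b); case: (copy f).
- apply/negP => /lt; by case: (b); case: (copy f).
- by move: succ le; case: (b); case: (copy f) => //= succ _ _; apply: succ.
Qed.

Lemma far_far_edge b e f f' :
  mate M (endpoint b e) = Some f -> mate M (endpoint (~~ b) e) = Some f' ->
  far b (copy f) -> far (~~ b) (copy f') ->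
  [/\ side_tier b (copy f) = 2%N, ~~ exceeds (endpoint b e) e f &
      side_tier (~~ b) (copy f) = 0%N -> exceeds (endpoint b e) f e].
Proof.
move=> mate_f mate_f' far_f far_f'.
(* This type has tier 2 on side [b] and tier 1 on the other, where the far edge [f'] cannot hold it
   off. *)
have [b' [g /= [mate_g le lt succ]]] := stabM (if b then Cc else Cx) e.
rewrite !tier_endpoint in le lt.
have b'b : b' = b.
  move: mate_g mate_f' far_f' le.
  by case: (b') (b) => [] [] // -> [->]; case: (copy f').
rewrite {b'}b'b in mate_g le lt succ.
move: mate_g; rewrite mate_f => -[fg]; rewrite -{g}fg in le lt succ.
move: far_f le lt succ; case: (b); case: (copy f) => //= _ _ lt succ.

all: by split; [| apply/negP => /lt | move=> // _; apply: succ].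
Qed.

Lemma same_half_edge b e f f' :
  mate M (endpoint b e) = Some f -> mate M (endpoint (~~ b) e) = Some f' ->
  far b (copy f) -> far b (copy f') ->
  ~~ (exceeds (endpoint b e) e f && exceeds (endpoint (~~ b) e) e f').
Proof.
move=> mate_f mate_f' far_f far_f'; apply/negP => /andP[ef ef'].
(* This type has tier 2 on side [b] and tier 0 on the other, so at neither end is the [M]-edge in a
   strictly better tier. *)
have [b' [g /= [mate_g _ lt _]]] := stabM (if b then Cb else Cy) e.
rewrite !tier_endpoint in lt.
have [b'b|b'b] : b' = b \/ b' = ~~ b by case: (b') (b) => [] []; auto.
  rewrite {b'}b'b mate_f in mate_g lt; case: mate_g => fg.
  by move: lt far_f; rewrite -fg => /(_ ef); case: (b); case: (copy f).
rewrite {b'}b'b mate_f' in mate_g lt; case: mate_g => fg.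
by move: lt far_f'; rewrite -fg => /(_ ef'); case: (b); case: (copy f').
Qed.


(** * The potential and popularity *)

Definition potential v : int :=
  if mate M v is Some f then (if (1 < tier v (copy f))%N then 1 else -1) else 0.

Lemma potential_some b e f : mate M (endpoint b e) = Some f ->
  potential (endpoint b e) = if far b (copy f) then 1 else -1.
Proof. by rewrite /potential => ->; rewrite tier_endpoint. Qed.

Lemma sum_potential : \sum_v potential v = 0.
Proof.
transitivity (\sum_(v | mate M v) potential v).
  rewrite [RHS]big_mkcond; apply: eq_bigr => v _.
  by rewrite /potential; case: mate.
rewrite sum_matched // big1 // => f fM.
rewrite (potential_some (mate_endpoint (b := false) mM fM erefl)).
rewrite (potential_some (mate_endpoint (b := true) mM fM erefl)).
by rewrite (far_negb false); case: far.
Qed.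

(** For [e] outside [M] with matched ends: if both are far, both vote 1; if one is far, some end
    votes 1; if none is, the potentials sum to -2. Next to an exposed end, the other has potential
    -1 and votes 1. *)
Lemma potential_edge N e : matching N -> e \in N ->
  potential (endpoint false e) + potential (endpoint true e) <=
  vote p gamma (endpoint false e) M N + vote p gamma (endpoint true e) M N.
Proof.
move=> mN eN; have Ne b := mate_endpoint (b := b) mN eN erefl.
have [eM|eM] := boolP (e \in M).
  have Me b := mate_endpoint (b := b) mM eM erefl.
  rewrite !vote_same ?Me ?Ne // !(potential_some (Me _)) (far_negb false).
  by case: far.
have vote_e b f : mate M (endpoint b e) = Some f ->
    vote p gamma (endpoint b e) M N =
    if exceeds (endpoint b e) e f then -1 else 1.
  move=> Mf; apply: (vote_some Mf (Ne b)); apply: contraNneq eM => ->.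
  by case: (mate_some Mf).
have exposed_le b : mate M (endpoint b e) = None ->
    potential (endpoint b e) + potential (endpoint (~~ b) e) <=
    vote p gamma (endpoint b e) M N + vote p gamma (endpoint (~~ b) e) M N.
  move=> none; have [f [Mf f0 nexc _]] := exposed_end none.
  rewrite (vote_e _ _ Mf) (negPf nexc) (potential_some Mf) /far f0.
  by rewrite /potential none add0r -lerBlDr; apply: le_trans (vote_ge _ _ _).
case Mu: (mate M (endpoint false e)) => [f|]; last exact: exposed_le Mu.
case Mw: (mate M (endpoint true e)) => [f'|]; last first.
  by rewrite addrC [leRHS]addrC; apply: (exposed_le true).
rewrite (vote_e _ _ Mu) (vote_e _ _ Mw) (potential_some Mu) (potential_some Mw).
have [ffar|fnear] := boolP (far false (copy f)).
  have [f'far|] := boolP (far true (copy f')).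
    have [_ /negPf-> _] := far_far_edge Mu Mw ffar f'far.
    by have [_ /negPf-> _] := @far_far_edge true _ _ _ Mw Mu f'far ffar.
  rewrite (far_negb false) negbK => f'far.
  by have := same_half_edge Mu Mw ffar f'far; do 2!case: exceeds.
rewrite -(far_negb false) /= in fnear.
have [f'far|] := boolP (far true (copy f')); last by do 2!case: exceeds.
by have := @same_half_edge true _ _ _ Mw Mu f'far fnear; do 2!case: exceeds.
Qed.

(** Votes minus potentials are nonnegative on each edge of [N] and at each agent unmatched by [N],
    and the potentials sum to 0. *)
Lemma stable_copies_popular : gamma_popular p gamma M.
Proof.
split=> // N mN; rewrite -sum_potential -subr_ge0 /Delta -sumrB.
rewrite (bigID (fun v => mate N v : bool)) /= addr_ge0 //.
  rewrite sum_matched // sumr_ge0 // => e eN.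
  by rewrite addrACA -opprD subr_ge0 potential_edge.
apply: sumr_ge0 => v; case Nv: (mate N v) => // _.
rewrite subr_ge0 (vote_exposed _ Nv) /potential.
by case: (mate M v) => // f; case: ifP.
Qed.

(** * Tips, fractional covers and the size bounds *)

Section SizeBounds.
Variable N : {set edge G}.
Hypothesis mN : matching N.

(** The Boolean names the side of the unmatched agent; the edge of [N] meets [f] on the opposite
    side. *)
Definition tip b f : bool :=
  [exists e in N, (endpoint (~~ b) e == endpoint (~~ b) f) &&
                  (mate M (endpoint b e) == None)].

Lemma tipP b f : f \in M -> tip b f ->
  exists2 e, e \in N & [/\ endpoint (~~ b) e = endpoint (~~ b) f,
    mate M (endpoint b e) = None, side_tier (~~ b) (copy f) = 0%N &
    side_tier b (copy f) = 2%N -> exceeds (endpoint (~~ b) f) f e].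
Proof.
move=> fM /exists_inP[e eN /andP[/eqP ef /eqP none]]; exists e => //.
have [g [mate_g g0 _ exc]] := exposed_end none.
have eq_gf : g = f.
  by move: mate_g; rewrite ef (mate_endpoint mM fM erefl) => -[].
by rewrite eq_gf ef in g0 exc; split.
Qed.

Lemma tip_far b f : f \in M -> tip b f -> far b (copy f).
Proof.
by move=> fM /(tipP fM)[e _ [_ _ f0 _]]; rewrite -(negbK b) far_negb /far f0.
Qed.

(** There is no augmenting path with a single edge of [M]: that edge would be far for both sides. *)
Lemma tip_negb b f : f \in M -> tip b f -> ~~ tip (~~ b) f.
Proof.
move=> fM tip_f; apply/negP => /(tip_far fM).
by rewrite far_negb (tip_far fM tip_f).
Qed.

(** Being a tip gives tier 0 on side [~~ b], and [far_far_edge] gives tier 2 on side [b]; each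
    enables the conditional conclusion of the other. The copy of [f] thus has type b or y. *)
Lemma tip_exceeds b e f f' : tip b f -> mate M (endpoint b e) = Some f ->
  mate M (endpoint (~~ b) e) = Some f' -> far (~~ b) (copy f') ->
  exists2 e0, e0 \in N & [/\ endpoint (~~ b) e0 = endpoint (~~ b) f,
    mate M (endpoint b e0) = None, exceeds (endpoint (~~ b) f) f e0 &
    exceeds (endpoint b f) f e].
Proof.
move=> tip_f Mf Mf' far_f'; have [fM fe] := mate_some Mf.
have [e0 e0N [e0f none f0 exc0]] := tipP fM tip_f.
have [f2 _ exc] := far_far_edge Mf Mf' (tip_far fM tip_f) far_f'.
by exists e0 => //; rewrite fe; split=> //; [apply: exc0 | apply: exc].
Qed.

Lemma tip_far_unstable b e f f' : e \in N -> tip b f ->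
  mate M (endpoint b e) = Some f -> mate M (endpoint (~~ b) e) = Some f' ->
  far (~~ b) (copy f') -> ~ gamma_min_stable p gamma N.
Proof.
move=> eN tip_f Mf Mf' far_f' [_ stabN].
have [e0 e0N [e0f none exc0 exc]] := tip_exceeds tip_f Mf Mf' far_f'.
have [fM fe] := mate_some Mf.
apply: (stabN f); split.
  (* If [f] were in [N], it would be [e0], which has an end unmatched by [M]. *)
  apply/negP => fN; have e0E : e0 = f.
    exact: ((matchingP N).1 mN _ _ _ e0N fN e0f).
  by move: none; rewrite e0E (mate_endpoint mM fM erefl).
move=> c; have [->|->] : c = b \/ c = ~~ b by case: (c) (b) => [] []; auto.
  by rewrite /= (mate_endpoint mN eN (esym fe)) /= -EFinD lee_fin.
by rewrite /= (mate_endpoint mN e0N e0f) /= -EFinD lee_fin.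
Qed.

(** Each tip is far, so [tip_exceeds] applies from both sides and yields the augmenting path
    [e0 f e f' e2] for the exchange. *)
Lemma tip_tip_unpopular b e f f' : e \in N -> tip b f -> tip (~~ b) f' ->
  mate M (endpoint b e) = Some f -> mate M (endpoint (~~ b) e) = Some f' ->
  ~ gamma_popular p gamma N.
Proof.
move=> eN tip_f tip_f' Mf Mf'.
have [fM fe] := mate_some Mf; have [fM' fe'] := mate_some Mf'.
have far_f := tip_far fM tip_f; have far_f' := tip_far fM' tip_f'.
have [e0 e0N [e0f none exc0 exc]] := tip_exceeds tip_f Mf Mf' far_f'.
have := @tip_exceeds (~~ b) e f' f tip_f' Mf'.
rewrite negbK => /(_ Mf far_f)[e2 e2N [e2f none2 exc2 exc']].
apply: (@swap_path_vote N b e0 e e2 f f') => //.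
rewrite /= !inE negb_or andbT -andbA; apply/and3P; split.
- by apply/eqP => e0E; move: none; rewrite e0E Mf.
- apply/eqP => e0E; move: none; rewrite e0E e2f.
  by rewrite (mate_endpoint mM fM' erefl).
- by apply/eqP => e2E; move: none2; rewrite -e2E Mf'.
Qed.

(** Weak duality: the total weight of a fractional vertex cover of [N] bounds [#|N|]. *)
Lemma fractional_cover (y : agent G -> R) (s : R) :
  (forall v, 0 <= y v) -> (forall v, mate M v = None -> y v = 0) ->
  (forall f, f \in M -> y (endpoint false f) + y (endpoint true f) <= s) ->
  (forall e, e \in N -> 1 <= y (endpoint false e) + y (endpoint true e)) ->
  #|N|%:R <= s * #|M|%:R.
Proof.
move=> y_ge0 y_none y_M y_N.
apply: (@le_trans _ _
  (\sum_(e in N) (y (endpoint false e) + y (endpoint true e)))).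
  by rewrite -sum1_card natr_sum; apply: ler_sum.
apply: (@le_trans _ _ (\sum_v y v)).
  rewrite -sum_matched // [leRHS](bigID (fun v => mate N v : bool)) /=.
  by rewrite lerDl sumr_ge0.
rewrite (_ : \sum_v y v = \sum_(v | mate M v) y v); last first.
  rewrite [RHS]big_mkcond; apply: eq_bigr => v _.
  by case Mv: (mate M v) => //; apply: y_none.
rewrite sum_matched // mulrC -sum1_card natr_sum mulr_suml.
by apply: ler_sum => f fM; rewrite mul1r; apply: y_M.
Qed.

(** Each inequality is the covering condition for one kind of [N]-edge: two non-tips give [h + h],
    [(s - h) + (s - h)] or [s]; a tip's end of weight [s - 1] meets [s - h] (near), [h] (far) or
    [s - 1] (opposite tip). The last two are required only if such edges occur. *)
Lemma card_le_of_tips (s h : R) :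
  [/\ 1 <= s, 2^-1 <= h, 2^-1 <= s - h & 2 <= 2 * s - h] ->
  (forall b e f f', e \in N -> tip b f ->
     mate M (endpoint b e) = Some f -> mate M (endpoint (~~ b) e) = Some f' ->
     [/\ tip (~~ b) f' -> 3 <= 2 * s & far (~~ b) (copy f') -> 2 <= s + h]) ->
  #|N|%:R <= s * #|M|%:R.
Proof.
move=> [s1 h2 sh2 sh] tips.
pose wt b f := if tip b f then s - 1 else if tip (~~ b) f then 1
  else if far b (copy f) then h else s - h.
pose side (v : agent G) := if v is inl _ then false else true.
have sideE b e : side (endpoint b e) = b by case: b.
pose y v := if mate M v is Some f then wt (side v) f else 0.
have yE b e f : mate M (endpoint b e) = Some f -> y (endpoint b e) = wt b f.
  by rewrite /y sideE => ->.
have wt_ge0 b f : 0 <= wt b f by rewrite /wt; do 3?case: ifP => _; lra.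
apply: (@fractional_cover y) => [v|v|f fM|e eN].
- by rewrite /y; case: (mate M v).
- by rewrite /y => ->.
- have Mf b := mate_endpoint (b := b) mM fM erefl.
  rewrite !(yE _ _ _ (Mf _)) /wt /= (far_negb false).
  have := tip_negb (b := false) fM; rewrite /=.
  do 2!case: (tip _ f) => //=; [by move=> /(_ isT)| | |case: far => /=]; lra.
have exposed_cover b : mate M (endpoint b e) = None ->
    1 <= y (endpoint b e) + y (endpoint (~~ b) e).
  move=> none; have [f [Mf _ _ _]] := exposed_end none.
  have [fM fe] := mate_some Mf.
  have tip_f : tip b f.
    by apply/exists_inP; exists e; rewrite // fe none !eqxx.
  rewrite (yE _ _ _ Mf) /wt negbK tip_f (negPf (tip_negb fM tip_f)).
  by rewrite /y none add0r.
have tip_cover b f f' : mate M (endpoint b e) = Some f ->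
    mate M (endpoint (~~ b) e) = Some f' -> tip b f ->
    1 <= wt b f + wt (~~ b) f'.
  move=> Mf Mf' tip_f; have [] := tips b e f f' eN tip_f Mf Mf'.
  rewrite /wt tip_f negbK.
  case: (tip (~~ b) f') => /= [/(_ isT) ? _|_]; first lra.
  case: (tip b f') => /= [_|]; first lra.
  by case: far => [/(_ isT)|_]; lra.
case Mu: (mate M (endpoint false e)) => [f|]; last exact: exposed_cover Mu.
case Mw: (mate M (endpoint true e)) => [f'|]; last first.
  by rewrite addrC; apply: (exposed_cover true).
rewrite (yE _ _ _ Mu) (yE _ _ _ Mw).
have [tip_f|/negPf ntip_f] := boolP (tip false f).
  exact: tip_cover Mu Mw _.
have [tip_f'|/negPf ntip_f'] := boolP (tip true f').
  by rewrite addrC; apply: (tip_cover true) Mw Mu _.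
rewrite /wt ntip_f ntip_f' /=.
case: (tip true f); case: (tip false f') => /=;
  case: (far false (copy f)); case: (far true (copy f')); lra.
Qed.

End SizeBounds.

End StableCopies.

End Duplication.

Theorem theorem3 (R : realType) (G : bigraph)
    (p gamma : agent G -> edge G -> R)
    (hp : forall v e, e \in incident v -> 0 <= p v e)
    (hgamma : forall v e, e \in incident v -> 0 < gamma v e)
    (M : {set edge G}) (hM : edge_duplication_output p gamma M) :
  [/\ gamma_popular p gamma M,
      forall N : {set edge G}, matching N ->
        2%:R / 3%:R * #|N|%:R <= #|M|%:R :> R,
      forall N : {set edge G}, gamma_popular p gamma N ->
        3%:R / 4%:R * #|N|%:R <= #|M|%:R :> R &
      forall N : {set edge G}, gamma_min_stable p gamma N ->
        4%:R / 5%:R * #|N|%:R <= #|M|%:R :> R].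
Proof.
have [mM [copy stabM]] := output_stable_copies hgamma hM.
split=> [|N mN|N popN|N stabN].
- exact: stable_copies_popular mM stabM.
- suff : #|N|%:R <= (3 / 2 : R) * #|M|%:R by lra.
  (* Here [3 <= 2 * s] and [2 <= s + h] both hold, so no configuration has to be excluded. *)
  apply: (card_le_of_tips mM stabM mN (h := 3 / 4)); first by split; lra.
  by move=> *; split=> _; lra.
- have [mN _] := popN.
  suff : #|N|%:R <= (4 / 3 : R) * #|M|%:R by lra.
  (* Now [s + h = 2] but [2 * s < 3]: popularity of [N] must exclude two facing tips. *)
  apply: (card_le_of_tips mM stabM mN (h := 2 / 3)); first by split; lra.
  move=> b e f f' eN tip_f Mf Mf'; split=> [tip_f'|_]; last lra.
  by case: (tip_tip_unpopular hgamma mM stabM mN eN tip_f tip_f' Mf Mf' popN).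
- have [mN _] := stabN.
  suff : #|N|%:R <= (5 / 4 : R) * #|M|%:R by lra.
  (* Now also [s + h < 2]: stability of [N] excludes a tip facing a far edge, hence also two facing
     tips. *)
  apply: (card_le_of_tips mM stabM mN (h := 1 / 2)); first by split; lra.
  move=> b e f f' eN tip_f Mf Mf'.
  have not_far := tip_far_unstable mM stabM mN eN tip_f Mf Mf'.
  split=> [/(tip_far mM stabM (mate_some Mf').1)|] /not_far; case; exact: stabN.
Qed.
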